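(* Let $H$ be a separable infinite-dimensional complex Hilbert space, let $k\in\mathbb N$, and let $\mathcal T=(T_1,\dots,T_k)\in B(H)^k$ satisfy $0\in\operatorname{Int}W_e(\mathcal T)$. Let $f:\mathbb N\to\mathbb N$ be any function satisfying $\lim_{m\to\infty}f(m)=\infty$. Then there exists an orthonormal basis $(u_n)_{n=1}^\infty$ of $H$ such that $$\operatorname{card}\bigl\{(n,j)\in\mathbb N\times\mathbb N:\ n,j\le m,\ \langle\mathcal Tu_j,u_n\rangle\ne0\bigr\}\le f(m)$$ for all $m\in\mathbb N$.
   Context: $B(H)$ is the space of bounded linear operators on $H$; $\mathbb N=\{1,2,\dots\}$. For $\mathcal T=(T_1,\dots,T_k)\in B(H)^k$ and $x,y\in H$, $\langle\mathcal Tx,y\rangle=(\langle T_1x,y\rangle,\dots,\langle T_kx,y\rangle)\in\mathbb C^k$, and $0$ also denotes the zero vector of $\mathbb C^k$. The (joint) essential numerical range $W_e(\mathcal T)$ is the set of all $\lambda=(\lambda_1,\dots,\lambda_k)\in\mathbb C^k$ for which there exists an orthonormal sequence $(x_n)_{n=1}^\infty\subset H$ with $\lim_{n\to\infty}\langle T_tx_n,x_n\rangle=\lambda_t$ for $t=1,\dots,k$. $\operatorname{Int}$ denotes the interior in $\mathbb C^k$. *)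

(* Defs.v *)
From HB Require Import structures.
From mathcomp Require Import all_boot all_order all_algebra.
From mathcomp Require Import sesquilinear complex.
From mathcomp Require Import all_classical all_reals all_analysis.

Set Implicit Arguments.
Unset Strict Implicit.
Unset Printing Implicit Defensive.

Import Order.TTheory GRing.Theory Num.Theory.
Import numFieldNormedType.Exports.

Local Open Scope classical_set_scope.
Local Open Scope complex_scope.
Local Open Scope ring_scope.

(* MathComp-Analysis puts the norm topology on the regular module K^o of a
   numFieldType K; as it does for its own abstract number types, we make it
   available on R[i] itself, so that 'rV[R[i]]_k carries the usual topology
   of C^k. *)
#[export, non_forgetful_inheritance]
HB.instance Definition _ (R : rcfType) :=
  PseudoPointedMetric.copy R[i] R[i]^o.
#[export, non_forgetful_inheritance]
HB.instance Definition _ (R : rcfType) := NormedModule.copy R[i] R[i]^o.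

Section Hilbert.
Context {R : realType} {H : completeNormedModType R[i]}.

Definition finite_dimensional : Prop :=
  exists (d : nat) (v : 'I_d -> H),
    forall x : H, exists c : 'I_d -> R[i], x = \sum_(i < d) c i *: v i.

Definition separable : Prop :=
  exists2 D : set H, countable D & dense D.

Definition bounded_operator (T : {linear H -> H}) : Prop :=
  exists M : R, forall x : H, `|T x| <= M%:C * `|x|.

(* An inner product is linear in its first argument, conjugate-linear in the
   second one. A complete normed space H over R[i] is a Hilbert space for
   [dot] when its norm is the one induced by [dot]. *)
Variable dot : {dot H for (Num.conj : R[i] -> R[i])}.

Definition hilbert_space : Prop := forall x : H, `|x| ^+ 2 = dot x x.

Definition orthonormal_sequence (u : nat -> H) : Prop :=
  forall i j : nat, dot (u i) (u j) = (i == j)%:R.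

Definition orthonormal_basis (u : nat -> H) : Prop :=
  orthonormal_sequence u /\
  forall x : H, (fun n => \sum_(i < n) dot x (u i) *: u i) @ \oo --> x.

Definition tuple_form (k : nat) (T : 'I_k -> {linear H -> H}) (x y : H) :
    'rV[R[i]]_k :=
  \row_t dot (T t x) y.

Definition essential_numerical_range (k : nat) (T : 'I_k -> {linear H -> H}) :
    set 'rV[R[i]]_k :=
  [set l | exists2 x : nat -> H, orthonormal_sequence x &
     forall t : 'I_k, (fun n => dot (T t (x n)) (x n)) @ \oo --> l 0 t].

(* The sequence u is indexed from 0: u i is the (i + 1)-st vector, so that
   'I_m indexes the first m vectors. *)
Definition nonzero_entries (k : nat) (T : 'I_k -> {linear H -> H})
    (u : nat -> H) (m : nat) : nat :=
  #|[pred p : 'I_m * 'I_m | tuple_form T (u p.2) (u p.1) != 0]|.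

End Hilbert.

Arguments finite_dimensional {R} H.
Arguments separable {R} H.

(* Main.v *)
(* Call a unit vector u with <T_t u, u> = 0 isolated from a finite set F when
   u is orthogonal to F and <T_t u, y> = <T_t y, u> = 0 for all y in F and t.
   Such vectors exist for every F: bounded functionals tend to 0 along
   orthonormal sequences, so every point of W_e(T) is approximated by <T x, x>
   with x in any subspace of finite codimension.  As 0 is interior, the 2k real
   coordinates of <T x, x> can be given any strict signs there.  They are then
   annihilated one at a time, by combining two vectors u, v that realise
   opposite signs of a coordinate and satisfy <T_t u, v> = <T_t v, u> = 0, so
   that <T x, x> at x = a u + b v is a weighted sum of its values at u and v.

   For the basis, fix a dense sequence (e_i) and fill the i-th block with
   vectors isolated from all the preceding ones and from e_0, ..., e_i; the last
   vector of the block is e_i minus its projection, normalised.  That vector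
   lies in the span of e_i and of the earlier blocks, so it couples only with
   itself and with the N vectors of the earlier blocks, and there are at most
   (N + 1)^2 nonzero entries so far; the block is taken so long that f is at
   least this bound from its end onwards. *)

Require Import Defs.
From mathcomp Require Import all_boot all_order all_algebra.
From mathcomp Require Import sesquilinear complex.
From mathcomp Require Import all_classical all_reals all_analysis.
From mathcomp Require Import ring lra.

Set Implicit Arguments.
Unset Strict Implicit.
Unset Printing Implicit Defensive.

Import Order.TTheory GRing.Theory Num.Theory.
Import numFieldNormedType.Exports.

Local Open Scope classical_set_scope.
Local Open Scope complex_scope.
Local Open Scope ring_scope.

(** * Inner products and bounded functionals *)

Section InnerProduct.
Context {R : realType} {H : completeNormedModType R[i]}.
Variable dot : {dot H for (Num.conj : R[i] -> R[i])}.
Hypothesis hH : hilbert_space dot.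

Lemma dotC x y : dot x y = (dot y x)^*%R.
Proof. by rewrite [LHS](hermC dot) expr0 mul1r. Qed.

Lemma dotDl x y z : dot (x + y) z = dot x z + dot y z.
Proof. exact: linearDl. Qed.

Lemma dotDr x y z : dot z (x + y) = dot z x + dot z y.
Proof. exact: linearDr. Qed.

Lemma dotZl a x z : dot (a *: x) z = a * dot x z.
Proof. exact: linearZl_LR. Qed.

Lemma dotZr a x z : dot z (a *: x) = a^*%R * dot z x.
Proof. exact: linearZr_LR. Qed.

Lemma dotBl x y z : dot (x - y) z = dot x z - dot y z.
Proof. exact: linearBl. Qed.

Lemma dotBr x y z : dot z (x - y) = dot z x - dot z y.
Proof. exact: linearBr. Qed.

Lemma dot0l z : dot 0 z = 0.
Proof. exact: linear0l. Qed.

Lemma dot0r z : dot z 0 = 0.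
Proof. exact: linear0r. Qed.

Lemma dot_suml n (F : 'I_n -> H) z :
  dot (\sum_(i < n) F i) z = \sum_(i < n) dot (F i) z.
Proof. exact: linear_sumlz. Qed.

Lemma dot_sumr n (F : 'I_n -> H) z :
  dot z (\sum_(i < n) F i) = \sum_(i < n) dot z (F i).
Proof. exact: linear_sumr. Qed.

Lemma dot_eq0C x y : dot x y = 0 -> dot y x = 0.
Proof. by rewrite dotC => /eqP; rewrite conjC_eq0 => /eqP. Qed.

Lemma dot_ge0 x : 0 <= dot x x. Proof. exact: dnorm_ge0. Qed.

Lemma dot_self_eq0 x : (dot x x == 0) = (x == 0).
Proof. exact: dnorm_eq0. Qed.

Lemma norm_dot_le x y : `|dot x y| <= `|x| * `|y|.
Proof.
have [->|y0] := eqVneq y 0; first by rewrite dot0r !normr0 mulr0.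
have ny : 0 < `|y| ^+ 2 by rewrite exprn_gt0// normr_gt0.
rewrite -(@ler_pXn2r _ 2)// ?nnegrE ?mulr_ge0// exprMn.
rewrite -(ler_pM2r ny).
(* Cauchy-Schwarz from positivity: this vector is [|y|^2] times the component of [x] orthogonal to
   [y], which avoids division. *)
have h : 0 <= dot (`|y| ^+ 2 *: x - dot x y *: y) (`|y| ^+ 2 *: x - dot x y *: y).
  exact: dot_ge0.
move: h; rewrite dotBl !dotBr !dotZl !dotZr -!hH.
have -> : (`|y| ^+ 2)^*%R = `|y| ^+ 2 by apply: conj_Creal; rewrite rpredX// normr_real.
rewrite [dot y x]dotC normCK.
set c := dot x y; set d := c^*%R; set X := `|x|; set Y := `|y|.
have -> : Y ^+ 2 * (Y ^+ 2 * X ^+ 2) - Y ^+ 2 * (d * c) -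
   (c * (Y ^+ 2 * d) - c * (d * Y ^+ 2)) = X ^+ 2 * Y ^+ 2 * Y ^+ 2 - c * d * Y ^+ 2 by ring.
by rewrite subr_ge0.
Qed.

(** Functionals are not represented by vectors, so that [dot (A x) y] as a function of [x] is
    covered without an adjoint of [A]. *)
Definition bounded_functional (phi : H -> R[i]) : Prop :=
  scalar phi /\ exists M : R, forall x, `|phi x| <= M%:C * `|x|.

Lemma bounded_functionalP phi : bounded_functional phi ->
  (forall a x y, phi (a *: x + y) = a * phi x + phi y).
Proof. by case=> + _ a x y; apply. Qed.

Lemma bounded_functional_dot y : bounded_functional (dot ^~ y).
Proof.
split; first by move=> a x z; rewrite dotDl dotZl.
exists (complex.Re `|y|) => x; rewrite RRe_real ?normr_real// mulrC.
exact: norm_dot_le.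
Qed.

Lemma bounded_functional_dot_comp (A : {linear H -> H}) y :
  bounded_operator A -> bounded_functional (fun x => dot (A x) y).
Proof.
move=> [M AM]; split; first by move=> a x z; rewrite linearP dotDl dotZl.
exists (complex.Re `|y| * M) => x.
rewrite rmorphM /= RRe_real ?normr_real// -mulrA mulrC.
by apply: le_trans (norm_dot_le _ _) _; rewrite ler_wpM2r.
Qed.

Lemma bounded_functional_sum phi n (c : 'I_n -> R[i]) (x : 'I_n -> H) :
  bounded_functional phi ->
  phi (\sum_(i < n) c i *: x i) = \sum_(i < n) c i * phi (x i).
Proof.
move=> /bounded_functionalP phiP.
have phi0 : phi 0 = 0.
  by have := phiP (- 1) 0 0; rewrite scaler0 addr0 mulN1r addNr.
elim: n => [|n IH] in c x *; first by rewrite !big_ord0.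
by rewrite !big_ord_recr/= addrC phiP IH addrC.
Qed.

(* Bessel's inequality for a functional that is not given as an inner
   product: test [phi] on the sum of the [(phi (x i))^* *: x i]. *)
Lemma bounded_functional_bessel phi (x : nat -> H) (M : R) n :
  bounded_functional phi ->
  (forall x, `|phi x| <= M%:C * `|x|) ->
  orthonormal_sequence dot x ->
  \sum_(i < n) `|phi (x i)| ^+ 2 <= M%:C ^+ 2.
Proof.
move=> phib phiM ox.
pose z := \sum_(i < n) (phi (x i))^*%R *: x i.
set s := \sum_(i < n) _.
have s0 : 0 <= s by apply: sumr_ge0 => i _; rewrite exprn_ge0.
have phiz : phi z = s.
  by rewrite bounded_functional_sum//; apply: eq_bigr => i _; rewrite mulrC normCK.
have nz : `|z| ^+ 2 = s.
  rewrite hH dot_suml; apply: eq_bigr => i _.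
  rewrite dotZl dot_sumr (bigD1 i)//= big1 ?addr0 => [|j ji].
    by rewrite dotZr ox eqxx mulr1 conjCK mulrC normCK.
  by rewrite dotZr ox (inj_eq val_inj) eq_sym (negbTE ji) mulr0.
have [->|sn0] := eqVneq s 0.
  by rewrite -rmorphXn /= ler0c sqr_ge0.
have sp : 0 < s by rewrite lt_def sn0.
have /(_ z) := phiM; rewrite phiz (ger0_norm s0) => h.
have : s ^+ 2 <= (M%:C * `|z|) ^+ 2.
  by rewrite ler_pXn2r ?nnegrE//; apply: le_trans h.
by rewrite exprMn nz expr2 ler_pM2r.
Qed.

(** By Bessel the series of the [|phi (x n)|^2] has bounded partial sums, so it converges and its
    terms tend to 0. *)
Lemma bounded_functional_weakly_null phi (x : nat -> H) :
  bounded_functional phi -> orthonormal_sequence dot x ->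
  (fun n => phi (x n)) @ \oo --> (0 : R[i]).
Proof.
move=> phib ox; have [M phiM] := phib.2.
pose a n : R := complex.Re (`|phi (x n)| ^+ 2).
have aC n : (a n)%:C = `|phi (x n)| ^+ 2.
  by rewrite RRe_real// realX// normr_real.
have a0 n : 0 <= a n by rewrite -ler0c aC exprn_ge0.
have /cvg_series_cvg_0 /cvgrPdist_lt a_cvg : cvgn (series a).
  apply: nondecreasing_is_cvgn.
    by apply/nondecreasing_seqP => n; rewrite /series/= big_nat_recr//= lerDl.
  exists (M ^+ 2) => _ [n _ <-]; rewrite -lecR rmorphXn /=.
  apply: le_trans (bounded_functional_bessel n phib phiM ox).
  by rewrite /series/= big_mkord rmorph_sum /=; apply: ler_sum => i _; rewrite aC.
apply/cvgrPdist_lt => e e0.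
have [r re] : exists r : R, e = r%:C.
  by apply/complex_realP; rewrite gtr0_real.
move: e0; rewrite re ltcR => r0.
have := a_cvg (r ^+ 2) (exprn_gt0 2 r0).
apply: filterS => n; rewrite !sub0r !normrN ger0_norm// => h.
rewrite -(@ltr_pXn2r _ 2)// ?nnegrE ?ler0c//; last exact: ltW.
by rewrite -aC -rmorphXn /= ltcR.
Qed.

End InnerProduct.

(** * Subspaces of finite codimension *)

Section FiniteCodimension.
Context {R : realType} {H : completeNormedModType R[i]}.
Variable dot : {dot H for (Num.conj : R[i] -> R[i])}.
Hypothesis hH : hilbert_space dot.

(** Finite intersections of kernels, generated one functional at a time so that a sequence can be
    corrected by induction. *)
Inductive finite_codimensional : set H -> Prop :=
| finite_codimensionalT : finite_codimensional setT
| finite_codimensional_ker V phi :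
    bounded_functional phi -> finite_codimensional V ->
    finite_codimensional (V `&` [set x | phi x = 0]).

Lemma finite_codimensional_linear V a x y :
  finite_codimensional V -> V x -> V y -> V (a *: x + y).
Proof.
elim=> [//|{}V phi phib _ IH] [Vx /= phix] [Vy /= phiy]; split; first exact: IH.
by rewrite /= (bounded_functionalP phib) phix phiy mulr0 addr0.
Qed.

Lemma finite_codimensional_kers (I : eqType) (r : seq I)
    (phi : I -> H -> R[i]) V :
  (forall i, bounded_functional (phi i)) -> finite_codimensional V ->
  finite_codimensional (V `&` [set x | {in r, forall i, phi i x = 0}]).
Proof.
move=> phib Vc; elim: r => [|i r IH].
  suff -> : [set x | {in [::], forall i, phi i x = 0}] = setT by rewrite setIT.
  by apply/seteqP; split.
suff -> : V `&` [set x | {in i :: r, forall i, phi i x = 0}] =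
    V `&` [set x | {in r, forall i, phi i x = 0}] `&` [set x | phi i x = 0].
  exact: finite_codimensional_ker.
apply/seteqP; split=> [x [Vx /= xr]|x [[Vx /= xr] /= xi]].
  split; first by split=> //= j jr; apply: xr; rewrite inE jr orbT.
  by apply: xr; rewrite inE eqxx.
by split=> // j; rewrite inE => /predU1P[->|/xr].
Qed.

Lemma cvg_conjC (z : nat -> R[i]) :
  z @ \oo --> (0 : R[i]) -> (fun n => (z n)^*%R) @ \oo --> (0 : R[i]).
Proof.
move=> /cvgrPdist_lt z0; apply/cvgrPdist_lt => e /z0.
by apply: filterS => n; rewrite !sub0r !normrN norm_conjC.
Qed.

(* Unification of [cvgD] and [cvgM] with the topology of [R[i]] is only
   tractable when [R[i]^o] is given explicitly. *)
Lemma cvg_complexD (y z : nat -> R[i]) a b :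
  y @ \oo --> (a : R[i]) -> z @ \oo --> (b : R[i]) ->
  (fun n => y n + z n) @ \oo --> (a + b : R[i]).
Proof. by move=> ya zb; exact: (@cvgD R[i] R[i]^o _ _ _ _ _ _ _ ya zb). Qed.

Lemma cvg_complexB (y z : nat -> R[i]) a b :
  y @ \oo --> (a : R[i]) -> z @ \oo --> (b : R[i]) ->
  (fun n => y n - z n) @ \oo --> (a - b : R[i]).
Proof. by move=> ya zb; exact: (@cvgB R[i] R[i]^o _ _ _ _ _ _ _ ya zb). Qed.

Lemma cvg_complexM (y z : nat -> R[i]) a b :
  y @ \oo --> (a : R[i]) -> z @ \oo --> (b : R[i]) ->
  (fun n => y n * z n) @ \oo --> (a * b : R[i]).
Proof. by move=> ya zb; exact: (@cvgM R[i] _ _ _ _ _ _ _ ya zb). Qed.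

Variables (k : nat) (T : 'I_k -> {linear H -> H}).
Hypothesis hT : forall t, bounded_operator (T t).

(* To enter the kernel of one more functional [phi], subtract from the
   sequence the vanishing multiples [phi (x n) *: v] of a vector [v] with
   [phi v = 1]. *)
Lemma essential_numerical_range_finite_codimensional V l :
  finite_codimensional V -> essential_numerical_range dot T l ->
  exists x : nat -> H, [/\ forall n, V (x n),
    forall phi, bounded_functional phi ->
      (fun n => phi (x n)) @ \oo --> (0 : R[i]) &
    forall t, (fun n => dot (T t (x n)) (x n)) @ \oo --> l 0 t].
Proof.
(* A corrected sequence need not be orthonormal; the induction keeps only its weak convergence to
   0. *)
move=> Vc [w ow wl]; elim: Vc => [|{}V phi phib Vc [x [xV x0 xl]]].
  exists w; split=> // phi phib; exact: bounded_functional_weakly_null phib ow.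
have phiP := bounded_functionalP phib.
have [kerV|/existsNP[v0 /not_implyP[Vv0 /eqP phiv0]]] :=
    pselect (forall v, V v -> phi v = 0).
  by exists x; split=> // n; split=> //; apply: kerV.
have phi0 : phi 0 = 0.
  by have := phiP (- 1) 0 0; rewrite scaler0 addr0 mulN1r addNr.
have V0 : V 0.
  by have := finite_codimensional_linear (- 1) Vc Vv0 Vv0; rewrite scaleN1r addNr.
pose v := (phi v0)^-1 *: v0.
have phiv : phi v = 1 by rewrite /v -[_ *: _]addr0 phiP phi0 addr0 mulVf.
have Vv : V v by rewrite /v -[_ *: _]addr0; apply: finite_codimensional_linear.
have phix := x0 _ phib.
exists (fun n => - phi (x n) *: v + x n); split=> [n|psi psib|t].
- split; first exact: finite_codimensional_linear.
  by rewrite /= phiP phiv mulr1 addNr.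
- rewrite (_ : (fun n => _) = (fun n => - phi (x n) * psi v + psi (x n))).
    have := cvgD (cvgM (cvgN phix) (cvg_cst (psi v))) (x0 _ psib).
    by rewrite oppr0 mul0r addr0; exact.
  by apply/funext => n; rewrite (bounded_functionalP psib).
(* In each of the three correction terms two factors tend to 0. *)
rewrite (_ : (fun n => _) = (fun n =>
    dot (T t (x n)) (x n) - (phi (x n))^*%R * dot (T t (x n)) v
     - phi (x n) * (dot (x n) (T t v))^*%R
     + phi (x n) * (phi (x n))^*%R * dot (T t v) v)); last first.
  apply/funext => n; rewrite [T t (_ + _)]linearP dotDl !dotDr !dotZl !dotZr.
  rewrite [dot (T t v) (x n)]dotC.
  by rewrite rmorphN /=; ring.
have z1 := cvg_conjC phix.
have z2 := x0 _ (bounded_functional_dot_comp hH v (hT t)).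
have z3 := cvg_conjC (x0 _ (bounded_functional_dot hH (T t v))).
have lE : l 0 t = l 0 t - 0 * 0 - 0 * 0 + 0 * 0 * dot (T t v) v.
  by rewrite !mul0r !subr0 addr0.
rewrite [X in _ --> X]lE.
have cst : (fun _ : nat => dot (T t v) v) @ \oo --> dot (T t v) v by exact: cvg_cst.
have := cvg_complexB (cvg_complexB (xl t) (cvg_complexM z1 z2)) (cvg_complexM phix z3).
move/cvg_complexD => /(_ _ _ (cvg_complexM (cvg_complexM phix z1) cst)); exact.
Qed.

End FiniteCodimension.

Lemma norm_complex_le (R : realType) (z : R[i]) :
  `|z| <= (`|complex.Re z| + `|complex.Im z|)%:C.
Proof.
rewrite [X in `|X|]complexE; apply: le_trans (ler_normD _ _) _.
rewrite normrM !normc_def /= !expr0n /= !addr0 !add0r expr1n sqrtr1 mul1r.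
by rewrite !sqrtr_sqr -rmorphD.
Qed.

Lemma normc_ge_Im (R : realType) (z : R[i]) : `|complex.Im z|%:C <= `|z|.
Proof.
by rewrite normc_def lecR -sqrtr_sqr ler_sqrt ?addr_ge0 ?sqr_ge0// lerDr sqr_ge0.
Qed.

(** * Existence of isolated unit vectors *)

Section Isolated.
Context {R : realType} {H : completeNormedModType R[i]}.
Variable dot : {dot H for (Num.conj : R[i] -> R[i])}.
Hypothesis hH : hilbert_space dot.
Variables (k : nat) (T : 'I_k -> {linear H -> H}).
Hypothesis hT : forall t, bounded_operator (T t).

Definition isolated (F : seq H) (u : H) : Prop :=
  {in F, forall y, dot u y = 0 /\
    forall t, dot (T t u) y = 0 /\ dot (T t y) u = 0}.

Definition isolated_unit (F : seq H) (u : H) : Prop :=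
  [/\ dot u u = 1, isolated F u & forall t, dot (T t u) u = 0].

(** Isolation amounts to three finite families of kernels. As [dot (T t y) u] is conjugate-linear in
    [u], its vanishing is expressed through [dot u (T t y)]. *)
Lemma finite_codimensional_isolated F V : finite_codimensional V ->
  exists2 W, finite_codimensional W & W `<=` V `&` isolated F.
Proof.
move=> Vc.
have f1 y : bounded_functional (fun x => dot x y) by exact: bounded_functional_dot.
pose p2 (q : H * 'I_k) x := dot (T q.2 x) q.1.
have f2 q : bounded_functional (p2 q).
  exact: bounded_functional_dot_comp.
pose p3 (q : H * 'I_k) x := dot x (T q.2 q.1).
have f3 q : bounded_functional (p3 q) by exact: bounded_functional_dot.
pose F2 := [seq (y, t) | y <- F, t <- enum 'I_k].
have F2in y t : y \in F -> (y, t) \in F2.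
  by move=> yF; apply/allpairsP; exists (y, t); rewrite mem_enum.
eexists.
  exact (finite_codimensional_kers F2 f3 (finite_codimensional_kers F2 f2
    (finite_codimensional_kers F f1 Vc))).
move=> x [[[Vx /= x1] /= x2] /= x3]; split=> // y yF; split; first exact: x1.
move=> t; split; first exact: (x2 _ (F2in y t yF)).
exact/dot_eq0C/(x3 _ (F2in y t yF)).
Qed.

Definition coordinate (i : 'I_k * bool) (u : H) : R :=
  let z := dot (T i.1 u) u in if i.2 then complex.Im z else complex.Re z.

(** Without cross terms the real scalars enter only through their squares, so coordinates combine
    with nonnegative weights. *)
Lemma coordinate_comb i (a b : R) u v :
  (forall t, dot (T t u) v = 0) -> (forall t, dot (T t v) u = 0) ->
  coordinate i (a%:C *: u + b%:C *: v) =
  a ^+ 2 * coordinate i u + b ^+ 2 * coordinate i v.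
Proof.
move=> uv vu; rewrite /coordinate.
have -> : T i.1 (a%:C *: u + b%:C *: v) = a%:C *: T i.1 u + b%:C *: T i.1 v.
  by rewrite linearP linearZ.
rewrite /= dotDl !dotDr !dotZl !dotZr.
rewrite uv vu !mulr0 addr0 add0r !mulrA.
have cC (c : R) : c%:C * (c%:C)^*%R = (c ^+ 2)%:C.
  by rewrite conj_Creal ?rmorphXn ?expr2//=; apply/complex_realP; exists c.
rewrite !cC; case: (dot (T i.1 u) u) => p q; case: (dot _ v) => r s /=.
by case: ifP => _ /=; simpc.
Qed.

Hypothesis hW : interior (essential_numerical_range dot T) 0.
Hypothesis hk : (0 < k)%N.

Lemma essential_numerical_range_corners : exists2 r : R, 0 < r &
  forall s : 'I_k * bool -> bool, essential_numerical_range dot T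
    (\row_t (((-1) ^+ s (t, false) * r) +i* ((-1) ^+ s (t, true) * r))).
Proof.
move: hW => /nbhs_ballP [e /= e0 he].
have [c ec] : exists c : R, e = c%:C.
  by apply/complex_realP; rewrite gtr0_real.
move: e0; rewrite ec ltcR => c0.
(* The entries of a corner have modulus at most [2 * (c / 3) < c]. *)
exists (c / 3); first by rewrite divr_gt0.
move=> s; apply: he; rewrite ec /=; split; first by rewrite ltcR.
move=> i j; rewrite -ball_normE /ball_ /= !mxE sub0r normrN.
apply: le_lt_trans (norm_complex_le _) _; rewrite /= ltcR.
rewrite !normrMsign gtr0_norm ?divr_gt0//.
lra.
Qed.

(** Induction on the list of annihilated coordinates. [V] and [s] stay general because the step uses
    the hypothesis twice, with opposite signs at the new coordinate and with the second vector in a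
    smaller subspace. *)
Lemma coordinate_signs (l : seq ('I_k * bool)) (s : 'I_k * bool -> bool) V :
  finite_codimensional V -> exists u, [/\ V u, u != 0 &
    forall i, if i \in l then coordinate i u = 0
      else 0 < (-1) ^+ s i * coordinate i u].
Proof.
elim: l => [|i l IH] in s V * => Vc.
  have [r r0 /(_ s) /(essential_numerical_range_finite_codimensional hH hT Vc)] :=
    essential_numerical_range_corners.
  move=> [x [xV _ xl]].
  have : \forall n \near \oo, forall i : 'I_k * bool,
      0 < (-1) ^+ s i * coordinate i (x n).
    apply: filter_forall => -[t b].
    (* Being at distance less than [r] from [r] or [-r] determines the sign. *)
    have /cvgrPdist_lt /(_ r%:C) := xl t; rewrite ltcR => /(_ r0).
    apply: filterS => n; rewrite mxE /coordinate /=.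
    case: (dot _ _) => p q.
    set z := (X in `|X|) => zr.
    have zRe := le_lt_trans (normc_ge_Re z) zr.
    have zIm : `|complex.Im z|%:C < r%:C.
      exact: le_lt_trans (normc_ge_Im z) zr.
    move: zRe zIm; rewrite /z !ltcR /= !ltr_norml.
    move=> /andP[r1 r2] /andP[r3 r4].
    case: b => /=.
      by case: (s (t, true)) r3 r4 => /=; rewrite ?expr0 ?expr1 => r3 r4; lra.
    by case: (s (t, false)) r1 r2 => /=; rewrite ?expr0 ?expr1 => r1 r2; lra.
  case=> n _ /(_ n (leqnn n)) xn; exists (x n); split=> //.
  (* [0 < k] supplies a coordinate, whose strict sign excludes the zero vector. *)
  apply/eqP => x0; have := xn (Ordinal hk, false).
  by rewrite /coordinate x0 dot0r /= mulr0 ltxx.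
have [il|il] := boolP (i \in l).
  have [u [Vu u0 us]] := IH s V Vc; exists u; split=> // j.
  by have := us j; rewrite inE; case: eqVneq => [->|//]; rewrite il.
have [u [Vu u0 us]] := IH (fun j => if j == i then false else s j) V Vc.
have [W Wc WV] := finite_codimensional_isolated [:: u] Vc.
have [v [/WV [Vv vu] v0 vs]] := IH (fun j => if j == i then true else s j) W Wc.
have [ovu oT] := vu u (mem_head _ _).
have := us i; rewrite (negbTE il) eqxx expr0 mul1r => ui.
have := vs i; rewrite (negbTE il) eqxx expr1 mulN1r => vi.
(* With these weights the [i]-th coordinate cancels; any other one vanishes at both [u] and [v] or
   has the same sign at both. *)
pose a := Num.sqrt (- coordinate i v); pose b := Num.sqrt (coordinate i u).
have cE j := @coordinate_comb j a b u v (fun t => (oT t).2) (fun t => (oT t).1).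
have a2 : a ^+ 2 = - coordinate i v by rewrite sqr_sqrtr// ltW.
have b2 : b ^+ 2 = coordinate i u by rewrite sqr_sqrtr// ltW.
exists (a%:C *: u + b%:C *: v); split.
- apply: finite_codimensional_linear => //.
  rewrite -[_ *: _]addr0; apply: finite_codimensional_linear => //.
  by rewrite -(addNr u) -scaleN1r; apply: finite_codimensional_linear.
(* Pairing with [v] leaves [b] times [dot v v], and [b ^+ 2 > 0]. *)
- apply/eqP => /(congr1 (fun w => dot w v)); rewrite dotDl !dotZl dot0l.
  rewrite (dot_eq0C ovu) mulr0 add0r => /eqP; rewrite mulf_eq0.
  rewrite dot_self_eq0 (negbTE v0) orbF => /eqP [] bv0.
  by move: b2; rewrite bv0 expr0n /= => uv0; rewrite -uv0 ltxx in ui.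
- move=> j; rewrite inE cE a2 b2; have := us j; have := vs j.
  case: (eqVneq j i) => [->|ji] /=; first by move=> _ _; rewrite mulNr mulrC addNr.
  case: ifP => _; first by move=> -> ->; rewrite !mulr0 addr0.
  move=> vj uj; rewrite mulrDr !(mulrCA ((-1) ^+ _)).
  by rewrite addr_gt0// mulr_gt0.
Qed.

Lemma exists_isolated_unit F : exists u, isolated_unit F u.
Proof.
have [W Wc WF] := finite_codimensional_isolated F finite_codimensionalT.
have [u [/WF [_ uF] u0 us]] := @coordinate_signs (enum {: 'I_k * bool}) (fun _ => false) W Wc.
have nu0 : `|u| != 0 by rewrite normr_eq0.
exists (`|u|^-1 *: u); split.
- rewrite dotZl dotZr -hH conj_Creal ?rpredV ?normr_real//.
  by rewrite mulrA -expr2 exprVn mulVf// expf_neq0.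
- move=> y /uF [uy uT]; rewrite dotZl uy mulr0; split=> // t.
  by rewrite [T t (_ *: _)]linearZ /= dotZl dotZr (uT t).1 (uT t).2 !mulr0.
- move=> t; rewrite [T t (_ *: _)]linearZ /= dotZl dotZr.
  have := us (t, true); have := us (t, false); rewrite !mem_enum /coordinate /=.
  by case: (dot _ _) => p q /= -> ->; rewrite !mulr0.
Qed.
End Isolated.

(** Course-of-values recursion: the list of earlier terms is accumulated by [rcons]. *)
Lemma exists_mkseq_rec (X : Type) (step : seq X -> X) :
  exists u : nat -> X, forall n, u n = step (mkseq u n).
Proof.
pose prefix n := iter n (fun s => rcons s (step s)) [::].
exists (fun n => step (prefix n)) => n; congr step.
by elim: n => [//|n IH]; rewrite mkseqS -IH.
Qed.

(** * Block boundaries: the [i]-th block runs from [p i] to [p i.+1 - 1] *)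

Section Blocks.
Variables (p : nat -> nat).
Hypotheses (p0 : p 0 = 0%N) (pS : forall i, (p i < p i.+1)%N).

Lemma blocks_lt i j : (i < j)%N -> (p i < p j)%N.
Proof. exact: (homo_ltn ltn_trans pS). Qed.

Lemma blocks_le i j : (i <= j)%N -> (p i <= p j)%N.
Proof. by rewrite leq_eqVlt => /predU1P[->//|/blocks_lt /ltnW]. Qed.

Lemma blocks_lt_inv i j : (p i < p j)%N -> (i < j)%N.
Proof. by apply: contraTT; rewrite -!leqNgt; apply: blocks_le. Qed.

Lemma blocks_ge i : (i <= p i)%N.
Proof. by elim: i => // i IH; apply: leq_ltn_trans IH (pS i). Qed.

Lemma blocks_inj : injective p.
Proof.
move=> i j pij; case: (ltngtP i j) => // /blocks_lt; rewrite pij ltnn//.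
Qed.

Lemma blocks_cover m : exists i, (p i <= m < p i.+1)%N.
Proof.
elim: m => [|m [i /andP[im mi]]]; first by exists 0%N; rewrite p0 (leq_ltn_trans _ (pS 0)).
have [lt|] := ltnP m.+1 (p i.+1); first by exists i; rewrite lt (leq_trans im).
move=> ge; exists i.+1; rewrite ge/=; exact: leq_ltn_trans mi (pS _).
Qed.

(** A block ending at [a] would put a boundary strictly between [p i] and [p i.+1]. *)
Lemma block_interior_notin i a b i' :
  (p i <= a)%N -> (a < b)%N -> p i.+1 = b.+1 -> p i'.+1 <> a.+1.
Proof.
move=> ia ab ib i'a.
have : (p i < p i'.+1)%N by rewrite i'a ltnS.
move/blocks_lt_inv; rewrite ltnS => ii'.
have : (p i'.+1 < p i.+1)%N by rewrite i'a ib.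
by move/blocks_lt_inv; rewrite ltnS ltnNge ii'.
Qed.

End Blocks.

Lemma exists_blocks (f : nat -> nat) : f @ \oo --> \oo ->
  exists p : nat -> nat, [/\ p 0 = 0%N, forall i, (p i < p i.+1)%N &
    forall i m, (p i.+1 <= m)%N -> ((p i).+1 ^ 2 <= f m)%N].
Proof.
move=> finf.
have /choice[N NP] : forall A, exists N, forall m, (N <= m)%N -> (A <= f m)%N.
  move=> A; have /cvgnyPge /(_ A) [N _ NA] := finf.
  by exists N => m; apply: NA.
(* From [N A] onwards [f] is at least [A]; the maximum with [p j] and the successor make [p]
   strictly increasing. *)
pose p := fix p i := if i is j.+1 then (maxn (p j) (N ((p j).+1 ^ 2)%N)).+1 else 0%N.
exists p; split=> // [i|i m] /=; first by rewrite ltnS leq_maxl.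
move=> h; apply: NP; apply: leq_trans h; apply: leqW; exact: leq_maxr.
Qed.

(** * Orthonormal expansions and dense sequences *)

Section Basis.
Context {R : realType} {H : completeNormedModType R[i]}.
Variable dot : {dot H for (Num.conj : R[i] -> R[i])}.
Hypothesis hH : hilbert_space dot.

Lemma separable_dense_sequence : separable H ->
  exists e : nat -> H, forall x (eps : R[i]), 0 < eps ->
    exists n, `|x - e n| < eps.
Proof.
move=> [D /countable_injP[g ginj] Ddense].
(* The [n]-th term is the point of [D] numbered [n], or 0 if there is none; extra terms do not
   affect density. *)
exists (fun n => xget 0 [set y | D y /\ g y = n]) => x eps eps0.
have [] := Ddense (ball x eps) _ (ball_open x eps).
  by exists x; apply: ballxx.
move=> y [xy Dy]; exists (g y).
have [Dz gz] : D (xget 0 [set z | D z /\ g z = g y]) /\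
    g (xget 0 [set z | D z /\ g z = g y]) = g y.
  by apply: (@xgetPex _ 0 [set z | D z /\ g z = g y]); exists y.
by move: xy; rewrite (ginj _ _ _ _ gz) ?inE// -ball_normE.
Qed.

Definition partial_sum (u : nat -> H) (n : nat) (x : H) : H :=
  \sum_(i < n) dot x (u i) *: u i.

Lemma partial_sumB u n x y :
  partial_sum u n (x - y) = partial_sum u n x - partial_sum u n y.
Proof.
by rewrite /partial_sum -sumrB; apply: eq_bigr => i _; rewrite dotBl scalerBl.
Qed.

Lemma partial_sumS u n x :
  partial_sum u n.+1 x = partial_sum u n x + dot x (u n) *: u n.
Proof. by rewrite /partial_sum big_ord_recr. Qed.

Lemma dot_partial_sum u n x y :
  dot (partial_sum u n x) y = \sum_(i < n) dot x (u i) * dot (u i) y.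
Proof. by rewrite dot_suml; apply: eq_bigr => i _; rewrite dotZl. Qed.

Lemma dot_sub_partial_sum u n x j :
  (forall a b, (a < n)%N -> (b < n)%N -> dot (u a) (u b) = (a == b)%:R) ->
  (j < n)%N -> dot (x - partial_sum u n x) (u j) = 0.
Proof.
move=> ou jn; rewrite dotBl dot_partial_sum (bigD1 (Ordinal jn))//= big1 => [|i ij].
  by rewrite ou// eqxx mulr1 addr0 subrr.
rewrite ou//; case: eqVneq => [ij'|]; last by rewrite mulr0.
by move: ij; rewrite -val_eqE /= ij' eqxx.
Qed.

(** The difference is orthogonal to the projection [P x], so its squared norm is [|x|^2 - <P x, x>],
    where [<P x, x>] is a sum of squared moduli. *)
Lemma norm_sub_partial_sum_le u n x :
  orthonormal_sequence dot u -> `|x - partial_sum u n x| <= `|x|.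
Proof.
move=> ou; rewrite -(@ler_pXn2r _ 2)// ?nnegrE// !hH dotBr.
rewrite [X in _ - X]dot_sumr big1 => [|j _].
  rewrite subr0 dotBl gerBl dot_partial_sum; apply: sumr_ge0 => i _.
  by rewrite [dot (u i) x]dotC -normCK exprn_ge0.
by rewrite dotZr dot_sub_partial_sum ?mulr0// => a b _ _; apply: ou.
Qed.

Lemma partial_sum_stable u n m x : orthonormal_sequence dot u ->
  (n <= m)%N -> x = partial_sum u n x -> x = partial_sum u m x.
Proof.
move=> ou /subnKC <- xn; elim: (m - n)%N => [|d IH]; first by rewrite addn0.
rewrite addnS partial_sumS -IH xn dot_partial_sum big1 ?scale0r ?addr0// => i _.
by rewrite ou; case: eqVneq => [E|]; [have := ltn_ord i; rewrite E ltnNge leq_addr|rewrite mulr0].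
Qed.

(** For large [m] the contraction [I - P_m] annihilates [e i], hence [|x - P_m x| = |(I - P_m) (x -
    e i)| <= |x - e i|]. *)
Lemma orthonormal_basis_of_dense u (e : nat -> H) :
  orthonormal_sequence dot u ->
  (forall x (eps : R[i]), 0 < eps -> exists n, `|x - e n| < eps) ->
  (forall i, exists n, e i = partial_sum u n (e i)) ->
  orthonormal_basis dot u.
Proof.
move=> ou edense espan; split=> // x; apply/cvgrPdist_lt => eps eps0.
have [i xi] := edense x eps eps0; have [n en] := espan i.
exists n => // m /= nm; apply: le_lt_trans xi.
have em := partial_sum_stable ou nm en.
have -> : x - \sum_(j < m) dot x (u j) *: u j =
    (x - e i) - partial_sum u m (x - e i).
  by rewrite partial_sumB -em opprB addrA subrK.
exact: norm_sub_partial_sum_le.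
Qed.
End Basis.

(** * The block construction and its count of nonzero entries *)

Section Construction.
Context {R : realType} {H : completeNormedModType R[i]}.
Variable dot : {dot H for (Num.conj : R[i] -> R[i])}.
Hypothesis hH : hilbert_space dot.
Variables (k : nat) (T : 'I_k -> {linear H -> H}).

Variables (e : nat -> H) (p : nat -> nat).
Hypotheses (p0 : p 0 = 0%N) (pS : forall i, (p i < p i.+1)%N).
Hypothesis isolated_unitP : forall F, exists u, isolated_unit dot T F u.

Let residual (u : nat -> H) n i := e i - partial_sum dot u n (e i).

(** As [i <= p i], the vectors [e 0, ..., e n] include the target of the block that contains [n]. *)
Let clean (u : nat -> H) n := isolated_unit dot T (mkseq u n ++ mkseq e n.+1) (u n).

Let dirty (u : nat -> H) n i := [/\ p i.+1 = n.+1, residual u n i != 0 &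
  u n = `|residual u n i|^-1 *: residual u n i].

(** A vanishing residual cannot be normalised. A clean vector then ends the block, and the equation
    in the first alternative records that the target is already spanned. *)
Lemma exists_block_sequence : exists u : nat -> H, forall n,
  (clean u n /\ forall i, p i.+1 = n.+1 -> e i = partial_sum dot u n (e i)) \/
  exists i, dirty u n i.
Proof.
have /choice[g gP] := isolated_unitP.
pose step s := let n := size s in
  let w := g (s ++ mkseq e n.+1) in
  (* The search is bounded since [p i.+1 = n.+1] forces [i <= n]. *)
  if [pick i : 'I_n.+1 | p i.+1 == n.+1] is Some i then
    let v := e i - partial_sum dot (nth 0 s) n (e i) in
    if v == 0 then w else `|v|^-1 *: v
  else w.
have [u uE] := exists_mkseq_rec step; exists u => n.
have := uE n; rewrite /step size_mkseq.
have psE i : partial_sum dot (nth 0 (mkseq u n)) n (e i) = partial_sum dot u n (e i).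
  by apply: eq_bigr => j _; rewrite nth_mkseq.
case: pickP => [i /eqP pi|pn].
  rewrite psE; case: (eqVneq (e i - _) 0) => [/eqP|v0 un]; last first.
    by right; exists i; split.
  rewrite subr_eq0 => /eqP ei un; left; split; first by rewrite /clean un.
  by move=> j; rewrite -pi => /(blocks_inj pS)[->].
move=> un; left; split; first by rewrite /clean un.
move=> i pi; have il : (i < n.+1)%N by rewrite -pi (leq_trans _ (blocks_ge pS i.+1)).
by have := pn (Ordinal il); rewrite /= pi eqxx.
Qed.

Variable u : nat -> H.
Hypothesis uP : forall n,
  (clean u n /\ forall i, p i.+1 = n.+1 -> e i = partial_sum dot u n (e i)) \/
  exists i, dirty u n i.

Lemma clean_prev n j : clean u n -> (j < n)%N ->
  dot (u n) (u j) = 0 /\ forall t, dot (T t (u n)) (u j) = 0 /\ dot (T t (u j)) (u n) = 0.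
Proof.
by move=> [_ iso _] jn; apply: iso; rewrite mem_cat map_f// mem_iota.
Qed.

Lemma clean_target n i : clean u n -> (i <= n)%N ->
  dot (u n) (e i) = 0 /\ forall t, dot (T t (u n)) (e i) = 0 /\ dot (T t (e i)) (u n) = 0.
Proof.
by move=> [_ iso _] jn; apply: iso; rewrite mem_cat (map_f e) ?orbT// mem_iota.
Qed.

(** Orthogonality of a residual to the earlier vectors rests on their orthonormality, hence the
    strong induction. *)
Lemma block_sequence_orthonormal : orthonormal_sequence dot u.
Proof.
have u1 n : dot (u n) (u n) = 1.
  have [[[]]//|[i [_ v0 ->]]] := uP n.
  rewrite dotZl dotZr -hH conj_Creal ?rpredV ?normr_real//.
  by rewrite mulrA -expr2 exprVn mulVf// expf_neq0// normr_eq0.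
have ult n : forall j, (j < n)%N -> dot (u n) (u j) = 0.
  elim/ltn_ind: n => n IH j jn.
  have [[uc _]|[i [_ v0 ->]]] := uP n; first exact: (clean_prev uc jn).1.
  rewrite dotZl dot_sub_partial_sum ?mulr0// => a b an bn.
  by case: ltngtP => [ab|ba|->]; rewrite ?u1//; [apply/dot_eq0C/IH|apply: IH].
move=> i j; case: ltngtP => [ij|ji|->]; rewrite ?u1//; last exact: ult.
exact/dot_eq0C/ult.
Qed.

(** Either [e i] was spanned before the last vector of its block, which is then clean and adds
    nothing, or that vector supplies exactly the residual. *)
Lemma block_sequence_span i : e i = partial_sum dot u (p i.+1) (e i).
Proof.
have ou := block_sequence_orthonormal.
have pn : p i.+1 = (p i.+1).-1.+1 by rewrite prednK// (leq_ltn_trans _ (pS i)).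
rewrite pn; set n := (p i.+1).-1 in pn *; rewrite partial_sumS.
have [[uc /(_ i pn) ei]|[j [pj v0 un]]] := uP n.
  rewrite (dot_eq0C (clean_target uc _).1) ?scale0r ?addr0//.
  by rewrite -ltnS -pn; apply: leq_trans (blocks_ge pS i.+1).
have ji : j = i by apply: (@succn_inj); apply: (blocks_inj pS); rewrite pj.
move: v0 un; rewrite {}ji {j pj} => v0 un.
(* The projection of [e i] is orthogonal to the residual. *)
have vv : dot (e i) (residual u n i) = `|residual u n i| ^+ 2.
  rewrite hH {2}/residual dotBl dot_partial_sum big1 ?subr0// => l _.
  by rewrite (dot_eq0C (dot_sub_partial_sum _ _ _)) ?mulr0// => a b _ _; apply: ou.
rewrite un dotZr vv scalerA conj_Creal ?rpredV ?normr_real//.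
rewrite expr2 mulKf ?normr_eq0// divff ?normr_eq0// scale1r.
by rewrite addrC subrK.
Qed.

Lemma block_sequence_diag t b : dot (T t (u b)) (u b) != 0 ->
  exists i, p i.+1 = b.+1.
Proof.
have [[[_ _ ->]]|[i [pi _ _]] _] := uP b; first by rewrite eqxx.
by exists i.
Qed.

(* A vector [u a] of the block preceding [u b] is orthogonal to the target
   [e i] of [u b], so [u b] lies in the span of [e i] and of the vectors of
   earlier blocks, from which [u a] is isolated. *)
Lemma block_sequence_offdiag t a b : (a < b)%N ->
  (dot (T t (u a)) (u b) != 0) || (dot (T t (u b)) (u a) != 0) ->
  exists2 i, p i.+1 = b.+1 & (a < p i)%N.
Proof.
move=> ab; have [[uc _]|[i [pi v0 ub]] nz] := uP b.
  by have [_ /(_ t)[-> ->]] := clean_prev uc ab; rewrite eqxx.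
exists i => //; rewrite ltnNge; apply: contraL nz => ia.
have block_clean l : (p i <= l)%N -> (l < b)%N -> clean u l.
  move=> il lb; have [[]//|[j [pj _ _]]] := uP l.
  by have := block_interior_notin pS il lb pi pj.
have ei_l l : (p i <= l)%N -> (l < b)%N -> dot (e i) (u l) = 0.
  move=> il lb; apply/dot_eq0C/(clean_target (block_clean l il lb) _).1.
  exact: leq_trans (blocks_ge pS i) il.
have ac := block_clean a ia ab.
have [_ /(_ t)[aei eia]] := clean_target ac (leq_trans (blocks_ge pS i) ia).
(* The projection of [e i] involves only vectors preceding [u a], so the isolation of the clean
   vector [u a] applies to them. *)
have small l : (l < b)%N -> dot (e i) (u l) != 0 -> (l < a)%N.
  by move=> lb; apply: contraNT; rewrite -leqNgt => al; rewrite ei_l// (leq_trans ia).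
rewrite negb_or !negbK ub; apply/andP; split; apply/eqP.
  rewrite dotZr dotBr aei sub0r dot_sumr big1 ?oppr0 ?mulr0// => l _.
  rewrite dotZr; have [->|/small -/(_ (ltn_ord l)) la] := eqVneq (dot (e i) (u l)) 0.
    by rewrite conjC0 mul0r.
  by have [_ /(_ t)[-> _]] := clean_prev ac la; rewrite mulr0.
rewrite [T t (_ *: _)]linearZ dotZl [T t (_ - _)]linearB dotBl eia sub0r.
rewrite [T t (partial_sum _ _ _ _)]linear_sum dot_suml big1 ?oppr0 ?mulr0// => l _.
rewrite [T t (_ *: _)]linearZ dotZl; have [->|/small -/(_ (ltn_ord l)) la] := eqVneq (dot (e i) (u l)) 0.
  by rewrite mul0r.
by have [_ /(_ t)[_ ->]] := clean_prev ac la; rewrite mulr0.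
Qed.

Lemma tuple_form_neq0 x y : tuple_form dot T x y != 0 ->
  exists t, dot (T t x) y != 0.
Proof.
move=> nz; apply/existsP; apply: contraNT nz; rewrite negb_exists => /forallP z.
by apply/eqP/rowP => t; rewrite !mxE; apply/eqP; rewrite -[_ == _]negbK.
Qed.

(** If block [i] is the last complete one, all nonzero entries lie in a square whose side consists
    of the [p i] indices below that block and of its end. *)
Lemma nonzero_entries_le (f : nat -> nat) m :
  (forall i m, (p i.+1 <= m)%N -> ((p i).+1 ^ 2 <= f m)%N) ->
  (nonzero_entries dot T u m <= f m)%N.
Proof.
move=> fP.
have entry (q : 'I_m * 'I_m) : tuple_form dot T (u q.2) (u q.1) != 0 ->
    exists2 i, (p i.+1 <= m)%N & forall x, x \in [:: val q.1; val q.2] ->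
      (x.+1 == p i.+1) || (x < p i)%N.
  case: q => x y /= /tuple_form_neq0[t nz].
  have [xy|yx|xy] := ltngtP (val x) (val y).
  - have [|i pi xi] := @block_sequence_offdiag t x y xy; first by rewrite nz orbT.
    exists i; first by rewrite pi ltn_ord.
    by move=> z; rewrite !inE => /orP[] /eqP->; rewrite ?xi ?orbT// pi eqxx.
  - have [|i pi xi] := @block_sequence_offdiag t y x yx; first by rewrite nz.
    exists i; first by rewrite pi ltn_ord.
    by move=> z; rewrite !inE => /orP[] /eqP->; rewrite ?xi ?orbT// pi eqxx.
  - have [|i pi] := @block_sequence_diag t x; first by rewrite {1}xy.
    exists i; first by rewrite pi ltn_ord.
    by move=> z; rewrite !inE -xy orbb => /eqP->; rewrite pi eqxx.
(* If [m < p 1], no block has ended and every entry is zero. *)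
have [[|i] /andP[im mi]] := blocks_cover p0 pS m.
  rewrite /nonzero_entries eq_card0// => q; apply/negbTE/negP => /entry[i im' _].
  by have := blocks_lt_inv pS (leq_ltn_trans im' mi).
apply: leq_trans (fP i m im).
pose A := [pred x : 'I_m | (x.+1 == p i.+1) || (x < p i)%N].
have cA : (#|A| <= (p i).+1)%N.
  rewrite cardE -(size_map val) -(size_iota 0 (p i)).
  apply: (@uniq_leq_size _ _ ((p i.+1).-1 :: iota 0 (p i))).
    by rewrite map_inj_uniq ?enum_uniq//; apply: val_inj.
  move=> _ /mapP[x + ->]; rewrite mem_enum inE => /orP[/eqP <-|xi].
    by rewrite mem_head.
  by rewrite inE mem_iota xi orbT.
apply: (@leq_trans (#|A| * #|A|)%N); last by rewrite -mulnn leq_mul.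
rewrite -cardX /nonzero_entries; apply: subset_leq_card; apply/fintype.subsetP => q /entry[j jm jq].
have ji : (j <= i)%N.
  by rewrite -ltnS -ltnS; apply: (blocks_lt_inv pS); apply: leq_ltn_trans jm mi.
(* For a block [j < i] both indices lie below [p j.+1 <= p i]. *)
have inA (x : 'I_m) : val x \in [:: val q.1; val q.2] -> x \in A.
  move=> /jq; rewrite inE; move: ji; rewrite leq_eqVlt => /predU1P[->//|ji].
  have pj := blocks_le pS ji.
  move=> /orP[/eqP xj|xj]; apply/orP; right; first by rewrite xj.
  by apply: leq_trans pj; apply: ltn_trans xj (pS j).
by case: q jq inA {jm} => x y /= _ inA; rewrite inE /= !inA ?inE ?eqxx ?orbT.
Qed.

End Construction.

(** * Assembly of the basis from the blocks *)

Unset Implicit Arguments.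

Theorem theorem1p3 (R : realType) (H : completeNormedModType R[i])
    (dot : {dot H for (Num.conj : R[i] -> R[i])})
    (hH : hilbert_space dot)
    (hsep : separable H)
    (hinf : ~ finite_dimensional H)
    (k : nat) (hk : (0 < k)%N)
    (T : 'I_k -> {linear H -> H})
    (hT : forall t : 'I_k, bounded_operator (T t))
    (hW : interior (essential_numerical_range dot T) 0)
    (f : nat -> nat)
    (hf1 : forall m : nat, (0 < m)%N -> (0 < f m)%N)
    (hf : f @ \oo --> \oo) :
  exists u : nat -> H,
    orthonormal_basis dot u /\
    forall m : nat, (0 < m)%N -> (nonzero_entries dot T u m <= f m)%N.
Proof.
have [p [p0 pS pf]] := exists_blocks hf.
have [e edense] := separable_dense_sequence hsep.
have iso F := exists_isolated_unit hH hT hW hk F.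
have [u uP] := exists_block_sequence e pS iso.
exists u; split=> [|m _]; last exact: (nonzero_entries_le p0 pS uP).
apply: (orthonormal_basis_of_dense hH _ edense).
  exact: (block_sequence_orthonormal hH uP).
by move=> i; exists (p i.+1); apply: (block_sequence_span hH pS uP).
Qed.
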